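(* Let $G$ be a (possibly infinite) graph. Then $\operatorname{glc}(G)\ge 2\lfloor \operatorname{odw}(G)/2\rfloor$. Moreover, if $G$ has a cycle, then there is a cycle $C$ of $G$ and two edge-disjoint paths $P,Q$ of $C$, both geodesic in $G$ and both of length $\lfloor \operatorname{odw}(G)/2\rfloor$, such that the loaded cycle $(C,E(P)\cup E(Q))$ is geodesic in $G$.
   Context: $d_G(u,v)$ denotes the length of a shortest $u$–$v$ path ($\infty$ if none). A connected subgraph $P$ of $G$ is geodesic in $G$ if $d_P(u,v)=d_G(u,v)$ for all $u,v\in V(P)$. A tree-decomposition of $G$ is a pair $(T,(B_t:t\in V(T)))$ where $T$ is a (possibly infinite) tree and $B_t\subseteq V(G)$, such that $V(G)=\bigcup_t B_t$; every edge has both ends in some $B_t$; and if $t_2$ lies on the $T$-path between $t_1,t_3$ then $B_{t_1}\cap B_{t_3}\subseteq B_{t_2}$. Its outer diameter is $\sup_t\max_{u,v\in B_t}d_G(u,v)$, and $\operatorname{odw}(G)$ is the minimum outer diameter over all tree-decompositions (possibly $\infty$, in which case $\lfloor\operatorname{odw}(G)/2\rfloor$ is read as $\infty$). A loaded cycle is a pair $(C,F)$ with $C$ a cycle of $G$ and $F\subseteq E(C)$; its load is $|F|$. For distinct $u,v\in V(C)$, $d_{C,F}(u,v)$ is the smaller of $|E(P')\cap F|,|E(Q')\cap F|$ where $P',Q'$ are the two paths of $C$ between $u,v$; $d_{C,F}(u,u)=0$. $(C,F)$ is geodesic if $d_G(u,v)\ge d_{C,F}(u,v)$ for all $u,v\in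 V(C)$. $\operatorname{glc}(G)$ is the maximum load of a geodesic loaded cycle of $G$, $\infty$ if there is no maximum, and $0$ if $G$ has no cycle.
   Formalization: If odw(G) is infinite, no path of a cycle has length ⌊odw(G)/2⌋ = ∞, so the second claim is then read as: for every finite k there are such C, P, Q with P and Q both of length k. *)

(* Defs.v *)
From HB Require Import structures.
From mathcomp Require Import all_boot all_order all_algebra finmap.
From mathcomp Require Import boolp classical_sets constructive_ereal.

Set Implicit Arguments.
Unset Strict Implicit.
Unset Printing Implicit Defensive.

Import Order.TTheory GRing.Theory Num.Theory.

Local Open Scope classical_set_scope.
Local Open Scope fset_scope.

(* Simple graphs, possibly infinite. An edge is the two-element set of its
   ends, and sets of edges occur below only as finite sets of such sets. *)
Record graph := Graph {
  vertex :> choiceType;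
  adj : rel vertex;
  adj_sym : symmetric adj;
  adj_irr : irreflexive adj
}.

Arguments adj : clear implicits.

(* Lengths and loads live in \bar int, with +oo for infinity. A nonempty set of
   elements that are naturals or +oo always has a least element and a least
   upper bound there, and the latter is its maximum or +oo. The first argument
   of [infimum] and [supremum] is the value taken on the empty set. *)
Definition enat (n : nat) : \bar int := (Posz n)%:E.

Definition floor_half (x : \bar int) : \bar int :=
  er_map (fun m : int => (m %/ 2)%Z) x.

Section Paths.
Variable V : choiceType.
Implicit Types (e : rel V) (s c : seq V) (u v : V) (A : {fset {fset V}}).

Definition is_path e s : bool :=
  if s is x :: p then path e x p && uniq s else false.

Definition path_length s : nat := (size s).-1.

Definition joins e u v s : bool :=
  [&& is_path e s, head u s == u & last u s == v].

Definition gdist e u v : \bar int :=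
  infimum +oo%E [set enat (path_length s) | s in [set s | joins e u v s]].

Definition path_edges s : {fset {fset V}} :=
  [fset [fset uv.1; uv.2] | uv in zip s (behead s)].

Definition cycle_edges c : {fset {fset V}} :=
  [fset [fset uv.1; uv.2] | uv in zip c (rot 1 c)].

Definition is_cycle e c : bool := [&& 2 < size c, cycle e c & uniq c].

Definition edge_rel A : rel V := [rel u v | [fset u; v] \in A].

Definition path_of_cycle c s : bool :=
  is_path (edge_rel (cycle_edges c)) s && all (mem c) s.

(* [arc c u v] stops just before [v]. *)
Definition cycle_arc c u v : seq V := rcons (arc c u v) v.

Definition load_dist c A u v : nat :=
  if u == v then 0
  else minn #|` path_edges (cycle_arc c u v) `&` A|
            #|` path_edges (cycle_arc c v u) `&` A|.

End Paths.

Section Graphs.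
Variable G : graph.

Definition dist : G -> G -> \bar int := gdist (adj G).

Definition geodesic_path (s : seq G) : Prop :=
  is_path (adj G) s /\
  {in s &, forall u v, gdist (edge_rel (path_edges s)) u v = dist u v}.

Definition has_cycle : Prop := exists c : seq G, is_cycle (adj G) c.

Definition loaded_cycle (c : seq G) (F : {fset {fset G}}) : Prop :=
  is_cycle (adj G) c /\ F `<=` cycle_edges c.

Definition geodesic_loaded_cycle (c : seq G) (F : {fset {fset G}}) : Prop :=
  loaded_cycle c F /\
  {in c &, forall u v, (enat (load_dist c F u v) <= dist u v)%O}.

Definition glc : \bar int :=
  supremum 0%E [set x | exists c F, geodesic_loaded_cycle c F
                                    /\ x = enat #|` F|].

Definition is_tree : Prop :=
  [/\ inhabited G,
      forall u v : G, exists s, joins (adj G) u v s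
    & ~ has_cycle].

Definition diameter (B : set G) : \bar int :=
  supremum 0%E [set dist u v | u in B & v in B].

End Graphs.

Record tree_decomposition (G : graph) := TreeDecomposition {
  td_tree : graph;
  td_bag : td_tree -> set G;
  td_is_tree : is_tree td_tree;
  td_vertex : forall v : G, exists t, td_bag t v;
  td_edge : forall u v : G, adj G u v -> exists t, td_bag t u /\ td_bag t v;
  td_path : forall (t1 t2 t3 : td_tree) (s : seq td_tree),
    joins (adj td_tree) t1 t3 s -> t2 \in s ->
    (td_bag t1 `&` td_bag t3 `<=` td_bag t2)%classic
}.

Definition outer_diameter (G : graph) (D : tree_decomposition G) : \bar int :=
  supremum 0%E (range (fun t => diameter (@td_bag G D t))).

Definition odw (G : graph) : \bar int :=
  infimum +oo%E [set x | exists D : tree_decomposition G, x = outer_diameter D].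

(* Main.v *)
Require Import Defs.
From mathcomp Require Import all_boot all_order all_algebra finmap.
From mathcomp Require Import boolp classical_sets constructive_ereal.
From mathcomp Require Import zify.

Set Implicit Arguments.
Unset Strict Implicit.
Unset Printing Implicit Defensive.

Import Order.TTheory GRing.Theory Num.Theory.

(** Layer each component of [G] by the distance [lev] from a root. The
    components of the subgraphs induced on the levels at least [i], together with
    their neighbours in level [i - 1], yield a tree-decomposition whose bags lie
    in two consecutive levels. If [2k <= odw G], some bag contains [u], [v] at
    distance at least [2k]. Follow shortest paths from [u] and [v] towards the root
    until they meet, and close them into a cycle by a path from [v] to [u] that
    stays in the levels at least [i]: as the levels of [u] and [v] differ by at
    most one, both descents have length at least [k], and their first [k] edges
    are the paths [P] and [Q]. Let [phi x] be the number of loaded edges met when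
    running along the cycle from [u] to [x]. The load distance of [x] and [y] is at
    most the distance of [phi x] and [phi y] modulo [2k], and this is at most their
    distance in [G], by comparing levels or, when [x] and [y] are on distinct
    descents, by the triangle inequality along [u], [x], [y], [v]. *)

(** * Extended naturals and distances *)

Section ExtendedNaturals.
Local Open Scope classical_set_scope.
Implicit Types (A : set (\bar int)) (x y : \bar int) (n : nat).

(** [infimum] and [supremum] fall back on a default when no bound is found; among these values the
    well-ordering of the naturals supplies one. *)
Definition is_enat x : Prop := (exists n, x = enat n) \/ x = +oo%E.

Lemma enat_le m n : (enat m <= enat n)%O = (m <= n).
Proof. by rewrite lee_fin lez_nat. Qed.

Lemma enat_ge0 n : (0 <= enat n)%E.
Proof. by rewrite lee_fin lez_nat. Qed.

Lemma is_enat_ge0 x : is_enat x -> (0 <= x)%E.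
Proof. by case=> [[n ->]|->]; rewrite ?enat_ge0 ?leey. Qed.

Lemma is_enat_ltS x n : is_enat x -> (x < enat n.+1)%E -> (x <= enat n)%E.
Proof. by case=> [[m ->]|->] //; rewrite ltNge !enat_le -ltnNge ltnS. Qed.

Lemma le_enat_oo x : (forall n, (enat n <= x)%E) -> x = +oo%E.
Proof.
case: x => [[m|m]||] // le_x; last by have := le_x 0.
  by have := le_x m.+1; rewrite enat_le ltnn.
by have := le_x 0.
Qed.

Lemma exists_infimums A :
  A !=set0 -> (forall x, A x -> is_enat x) -> infimums A !=set0.
Proof.
move=> [x0 Ax0] enA; have [[n An]|noA] := pselect (exists n, A (enat n)).
  have exA : exists n, `[< A (enat n) >] by exists n; apply/asboolP.
  case: (ex_minnP exA) => m /asboolP Am minm.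
  exists (enat m); split=> [x Ax|y]; last exact.
  have [[k xk]|->] := enA x Ax; last by rewrite leey.
  by rewrite xk enat_le minm //; apply/asboolP; rewrite -xk.
exists +oo%E; split=> [x Ax|y _]; last by rewrite leey.
have [[k xk]|->] := enA x Ax; last by [].
by case: noA; exists k; rewrite -xk.
Qed.

Lemma exists_supremums A :
  A !=set0 -> (forall x, A x -> is_enat x) -> supremums A !=set0.
Proof.
move=> [x0 Ax0] enA.
have [[n An]|noA] := pselect (exists n, ubound A (enat n)).
  have exA : exists n, `[< ubound A (enat n) >] by exists n; apply/asboolP.
  case: (ex_minnP exA) => m /asboolP Am minm.
  exists (enat m); split=> // y uby.
  have := le_trans (is_enat_ge0 (enA _ Ax0)) (uby _ Ax0).
  case: y uby => [[k|k]||] // uby _; rewrite ?leey // enat_le minm //.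
  exact/asboolP.
exists +oo%E; split=> [x _|y uby]; first by rewrite leey.
(* An upper bound below some [n] would make [n] a natural upper bound, so every upper bound exceeds
   all naturals. *)
rewrite leye_eq; apply/eqP/le_enat_oo => n; rewrite leNgt; apply/negP => lt_yn.
by apply: noA; exists n => x /uby le_xy; apply: le_trans le_xy (ltW lt_yn).
Qed.

Lemma supremum_ubound A x :
  (forall x, A x -> is_enat x) -> A x -> (x <= supremum 0%E A)%E.
Proof.
move=> enA Ax; have A0 : A !=set0 by exists x.
rewrite /supremum ifF; last by apply/negP => /eqP A0'; rewrite A0' in Ax.
by have [ub _] := xgetPex 0%E (exists_supremums A0 enA); apply: ub.
Qed.

Lemma supremum_lub A y :
  (forall x, A x -> is_enat x) -> (0 <= y)%E -> (forall x, A x -> (x <= y)%E) ->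
  (supremum 0%E A <= y)%E.
Proof.
move=> enA y0 uby; rewrite /supremum; case: ifPn => // /set0P A0.
by have [_] := xgetPex 0%E (exists_supremums A0 enA); apply.
Qed.

Lemma is_enat_supremum A :
  (forall x, A x -> is_enat x) -> is_enat (supremum 0%E A).
Proof.
move=> enA; suff: (0 <= supremum 0%E A)%E.
  by case: (supremum _ _) => [[n|n]||] // _; [left; exists n | right].
rewrite /supremum; case: ifPn => // /set0P[x Ax].
have A0 : A !=set0 by exists x.
have [ub _] := xgetPex 0%E (exists_supremums A0 enA).
exact: le_trans (is_enat_ge0 (enA _ Ax)) (ub _ Ax).
Qed.

Lemma infimum_lbound A x :
  (forall x, A x -> is_enat x) -> A x -> (infimum +oo%E A <= x)%E.
Proof.
move=> enA Ax; have A0 : A !=set0 by exists x.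
rewrite /infimum ifF; last by apply/negP => /eqP A0'; rewrite A0' in Ax.
by have [ub _] := xgetPex +oo%E (exists_infimums A0 enA); apply: ub.
Qed.

Lemma infimum_glb A y :
  (forall x, A x -> is_enat x) -> (forall x, A x -> (y <= x)%E) ->
  (y <= infimum +oo%E A)%E.
Proof.
move=> enA lby; rewrite /infimum; case: ifPn => [_|/set0P A0]; first exact: leey.
by have [_] := xgetPex +oo%E (exists_infimums A0 enA); apply.
Qed.

Lemma is_enat_infimum A :
  (forall x, A x -> is_enat x) -> is_enat (infimum +oo%E A).
Proof.
move=> enA; have: (0 <= infimum +oo%E A)%E.
  by apply: infimum_glb => // x /enA/is_enat_ge0.
by case: (infimum _ _) => [[n|n]||] // _; [left; exists n | right].
Qed.

End ExtendedNaturals.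

Section Distances.
Variable V : choiceType.
Implicit Types (e : rel V) (u v : V) (p : seq V) (n : nat).

Lemma is_enat_gdist e u v : is_enat (gdist e u v).
Proof. by apply: is_enat_infimum => _ [s _ <-]; left; eexists. Qed.

(** Every walk contains a path with the same ends, so distances can be handled through walks, which
    concatenate freely. *)
Lemma gdist_le e u v p : path e u p -> last u p = v ->
  (gdist e u v <= enat (size p))%E.
Proof.
move=> up <-; case: (shortenP up) => q uq Uq sub.
apply: (@le_trans _ _ (enat (size q))).
  apply: infimum_lbound; first by move=> _ [s _ <-]; left; eexists.
  by exists (u :: q) => //; rewrite /= /joins /is_path uq Uq /= ?eqxx.
by rewrite enat_le uniq_leq_size //; case/andP: Uq.
Qed.

Lemma le_gdist e u v n :
  (forall p, path e u p -> last u p = v -> n <= size p) ->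
  (enat n <= gdist e u v)%E.
Proof.
move=> le_n; apply: infimum_glb; first by move=> _ [s _ <-]; left; eexists.
move=> _ [[|u' p] //= + <-]; rewrite /joins /= => /and3P[/andP[up _] /eqP uu' /eqP].
by rewrite enat_le; rewrite uu' in up *; apply: le_n.
Qed.

Lemma gdist_geP e u v n : (enat n <= gdist e u v)%E ->
  forall p, path e u p -> last u p = v -> n <= size p.
Proof. by move=> le_n p up pv; rewrite -enat_le (le_trans le_n) ?gdist_le. Qed.

Lemma gdistE e u v p : path e u p -> last u p = v ->
  (forall q, path e u q -> last u q = v -> size p <= size q) ->
  gdist e u v = enat (size p).
Proof.
by move=> up pv min_p; apply/le_anti; rewrite gdist_le //= le_gdist.
Qed.

End Distances.

(** * Loads along a cycle *)

Section PathEdges.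
Variable V : choiceType.
Local Open Scope fset_scope.
Implicit Types (x y u v : V) (p s c : seq V) (A F : {fset {fset V}}).

Lemma path_edges0 : path_edges [::] = fset0 :> {fset {fset V}}.
Proof. by apply/fsetP => a; apply/imfsetP => -[]. Qed.

Lemma path_edges1 x : path_edges [:: x] = fset0.
Proof. by apply/fsetP => a; apply/imfsetP => -[]. Qed.

Lemma path_edges_cons2 x y s :
  path_edges [:: x, y & s] = [fset x; y] |` path_edges (y :: s).
Proof.
apply/fsetP => a; rewrite in_fset1U; apply/imfsetP/orP => /=.
  case=> uv; rewrite inE => /predU1P[-> /= ->|uvs ->]; first by left.
  by right; apply/imfsetP; exists uv.
case=> [/eqP ->|/imfsetP[uv /= uvs ->]].
  by exists (x, y); rewrite // inE eqxx.
by exists uv; rewrite // inE uvs orbT.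
Qed.

Lemma path_edgesP s a :
  reflect (exists s1 s2 x y, s = s1 ++ [:: x, y & s2] /\ a = [fset x; y])
          (a \in path_edges s).
Proof.
apply: (iffP idP) => [|[s1 [s2 [x [y [-> ->]]]]]]; last first.
  elim: s1 => [|z s1 IHs1]; first by rewrite /= path_edges_cons2 fset1U1.
  by case: s1 IHs1 => [|z' s1] IHs1; rewrite /= path_edges_cons2 in_fset1U IHs1 orbT.
elim: s => [/imfsetP[]//|x [_|y s IHs]]; first by rewrite path_edges1.
rewrite path_edges_cons2 in_fset1U => /predU1P[->|/IHs[s1 [s2 [z [t [-> ->]]]]]].
  by exists [::], s, x, y.
by exists (x :: s1), s2, z, t.
Qed.

Arguments path_edgesP {s a}.

Lemma path_edges_sub s s1 s2 : path_edges s `<=` path_edges (s1 ++ s ++ s2).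
Proof.
apply/fsubsetP => a /path_edgesP[t1 [t2 [x [y [-> ->]]]]].
by apply/path_edgesP; exists (s1 ++ t1), (t2 ++ s2), x, y; rewrite -!catA.
Qed.

Lemma path_edges_rev s : path_edges (rev s) = path_edges s.
Proof.
have sub (t : seq V) : path_edges (rev t) `<=` path_edges t.
  apply/fsubsetP => a /path_edgesP[t1 [t2 [x [y [def_t ->]]]]].
  apply/path_edgesP; exists (rev t2), (rev t1), y, x; split; last exact: fsetUC.
  by rewrite -[t]revK def_t rev_cat !rev_cons -!cats1 -!catA.
by apply/eqP; rewrite eqEfsubset sub -{1}[s]revK !sub.
Qed.

(** [zip] stops with the shorter list, so the final [y] of the first list has no partner. *)
Lemma zip_rcons_behead x p y : zip (x :: rcons p y) (rcons p y) = zip (x :: p) (rcons p y).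
Proof. by elim: p x => //= z p IHp x; rewrite IHp. Qed.

Lemma cycle_edgesE x p : cycle_edges (x :: p) = path_edges (x :: rcons p x).
Proof. by rewrite /cycle_edges /path_edges rot1_cons [behead _]/= zip_rcons_behead. Qed.

Lemma path_edge_rel A x p :
  path (edge_rel A) x p = (path_edges (x :: p) `<=` A).
Proof.
elim: p x => [|y p IHp] x; first by rewrite path_edges1 fsub0set.
by rewrite path_edges_cons2 fsubUset fsub1set /= IHp.
Qed.

Lemma path_edges_mem s x y : [fset x; y] \in path_edges s -> x \in s.
Proof.
case/path_edgesP=> s1 [s2 [z [t [-> /fsetP/(_ x)]]]].
by rewrite !inE eqxx mem_cat !inE => /esym/orP[]->; rewrite ?orbT.
Qed.

Lemma card_path_edges s : uniq s -> #|` path_edges s| = path_length s.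
Proof.
elim: s => [|x [|y s] IHs]; rewrite ?path_edges0 ?path_edges1 ?cardfs0 //.
case/andP=> xs Us.
rewrite path_edges_cons2 cardfsU1 (IHs Us) /path_length /= (_ : _ \notin _) //.
by apply: contra xs => /path_edges_mem.
Qed.

Lemma path_edges_cat x p q :
  path_edges (x :: p ++ q) = path_edges (x :: p) `|` path_edges (last x p :: q).
Proof.
elim: p x => [|y p IHp] x; first by rewrite path_edges1 fset0U.
by rewrite /= !path_edges_cons2 IHp fsetUA.
Qed.

Section Load.
Variables (F : {fset {fset V}}) (phi : V -> nat) (K : nat).
Hypothesis phiF : forall x y,
  [fset x; y] \in F -> phi x = (phi y).+1 \/ phi y = (phi x).+1.

Let load s := #|` path_edges s `&` F|.

(** A loaded edge changes [phi] by exactly one and, [phi] being nondecreasing here, raises it; the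
    loaded edges are therefore at most the total rise. *)
Lemma load_le x p : path (fun a b => phi a <= phi b) x p ->
  phi x + load (x :: p) <= phi (last x p).
Proof.
elim: p x => [|y p IHp] x; first by rewrite /load path_edges1 fset0I cardfs0 addn0.
case/andP=> xy /IHp /=; apply: leq_trans.
rewrite /load path_edges_cons2 fsetIUl cardfsU.
apply: leq_trans (leq_trans (leq_add (leqnn _) (leq_subr _ _)) _) _.
  exact: leqnn.
rewrite addnA leq_add2r.
have [xyF|xyF] := boolP ([fset x; y] \in F); last first.
  by rewrite (_ : _ `&` _ = fset0) ?cardfs0 ?addn0 //; apply/fsetP => a; rewrite !inE; case: eqP => // ->; apply/negbTE.
apply: (@leq_trans (phi x + #|` [fset [fset x; y]]|)).
  by rewrite leq_add2l fsubset_leq_card // fsubsetIl.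
by rewrite cardfs1; case: (phiF xyF); lia.
Qed.

Lemma load_cat x p q : load (x :: p ++ q) <= load (x :: p) + load (last x p :: q).
Proof. by rewrite /load path_edges_cat fsetIUl cardfsU leq_subr. Qed.

(** Subtraction being truncated, the sum of the two differences is [|phi x - phi y|], and the bound
    is the distance of the values modulo [K]. One arc stays inside the list, where [phi] rises; the
    other passes its end and carries at most the rise up to [K] plus the rise from [phi c0 = 0]. *)
Lemma load_dist_le (c0 : V) c x y :
  uniq (c0 :: c) -> path (fun a b => phi a <= phi b) c0 c ->
  phi c0 = 0 -> phi (last c0 c) = K -> 1 < K ->
  x \in c0 :: c -> y \in c0 :: c ->
  load_dist (c0 :: c) F x y <= minn (phi x - phi y + (phi y - phi x))
                                    (K - (phi x - phi y + (phi y - phi x))).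
Proof.
move=> Uc mono phi0 phiK K1.
have main u v : u != v -> forall c1 c2 c3, c0 :: c = c1 ++ u :: c2 ++ v :: c3 ->
    load_dist (c0 :: c) F u v <= minn (phi u - phi v + (phi v - phi u))
                                      (K - (phi u - phi v + (phi v - phi u))).
  move=> uv c1 c2 c3 def_c.
  (* Arcs are invariant under rotation, and with [u] in front they are the stretches before and
     after [v]. *)
  have rot_c : rot (size c1) (c0 :: c) = u :: c2 ++ v :: (c3 ++ c1).
    by rewrite def_c rot_size_cat /= -catA.
  have Ur : uniq (u :: c2 ++ v :: (c3 ++ c1)) by rewrite -rot_c rot_uniq.
  have uc : u \in c0 :: c by rewrite def_c !(mem_cat, inE) eqxx orbT.
  have vc : v \in c0 :: c by rewrite def_c !(mem_cat, inE) eqxx !orbT.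
  rewrite /load_dist (negbTE uv) /cycle_arc.
  rewrite -(arc_rot (size c1) Uc uc) -(arc_rot (size c1) Uc vc) rot_c.
  rewrite left_arc // right_arc //.
  rewrite -!/(load _) /=.
  have sorted_c : sorted (fun a b => phi a <= phi b) (c1 ++ u :: c2 ++ v :: c3).
    by rewrite -def_c.
  have le_uv : phi u + load (u :: rcons c2 v) <= phi v.
    have := @load_le u (rcons c2 v); rewrite last_rcons; apply.
    move: sorted_c; case: c1 {def_c rot_c Ur} => [|? ?] /=; rewrite cat_path /=.
      by rewrite rcons_path; case/and3P=> -> ->.
    by rewrite cat_path rcons_path /=; case/and5P=> _ _ -> -> _.
  have le_vl : phi v + load (v :: c3) <= K.
    rewrite -phiK; have -> : last c0 c = last v c3.
      by rewrite -[last c0 c]/(last c0 (c0 :: c)) def_c !(last_cat, last_cons).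
    apply: load_le.
    move: sorted_c; case: c1 {def_c rot_c Ur} => [|? ?] /=; rewrite cat_path /=.
      by case/and3P.
    by rewrite cat_path /=; case/and5P.
  have [t def_t] : exists t, rcons c1 u = c0 :: t.
    case: c1 def_c {rot_c Ur sorted_c} => [[<- _]|? c1 [<- _]]; first by exists [::].
    by exists (rcons c1 u).
  have le_cu : load (c0 :: t) <= phi u.
    have -> : phi u = phi (last c0 t).
      by rewrite -[last c0 t]/(last c0 (c0 :: t)) -def_t last_rcons.
    rewrite -[load _]add0n -phi0 load_le //.
    rewrite -[path _ _ _]/(sorted _ (c0 :: t)) -def_t.
    by case: c1 sorted_c {def_c rot_c Ur def_t} => //= ? ?; rewrite cat_path rcons_path => /andP[-> /=]/andP[].
  (* The closing edge joins the values [K] and [0], which differ by more than one, so it is not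
     loaded. *)
  have junction : load [:: last v c3; c0] = 0.
    rewrite /load path_edges_cons2 path_edges1 fsetU0; apply/eqP; rewrite cardfs_eq0.
    apply/eqP/fsetP => a; rewrite !inE; case: eqP => // -> /=; apply/negP => /phiF.
    suff -> : phi (last v c3) = K by rewrite phi0; lia.
    rewrite -phiK; congr phi.
    by rewrite -[RHS]/(last c0 (c0 :: c)) def_c !(last_cat, last_cons).
  have le_vu : load (v :: rcons (c3 ++ c1) u) <= K - phi v + phi u.
    rewrite -cats1 -catA cats1 def_t -cat1s.
    have := load_cat v c3 (c0 :: t).
    have := load_cat (last v c3) [:: c0] t; rewrite junction /=; lia.
  lia.
move=> xc yc; have [->|xy] := eqVneq x y; first by rewrite /load_dist eqxx.
have mem_split (z : V) (s : seq V) : z \in s -> exists s1 s2, s = s1 ++ z :: s2.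
  by case/splitPr=> s1 s2; exists s1, s2.
have [c1 [c2 def_c]] := mem_split _ _ xc.
move: yc; rewrite def_c mem_cat inE eq_sym (negbTE xy) -def_c => /orP[] /mem_split[t1 [t2 def_s]].
  (* Here [y] comes first; both sides are symmetric in [x] and [y]. *)
  rewrite /load_dist eq_sym minnC addnC -/(load_dist _ _ y x).
  by apply: main; rewrite 1?eq_sym // def_c def_s -catA.
by apply: main; rewrite // def_c def_s.
Qed.
End Load.
End PathEdges.

(** * Descending paths *)

Lemma path_rev (V : eqType) (e : rel V) x p : symmetric e -> path e x p ->
  path e (last x p) (rev (belast x p)) /\ last (last x p) (rev (belast x p)) = x.
Proof.
move=> e_sym xp; split; last first.
  by case: p {xp} => //= y p; rewrite rev_cons last_rcons.
by rewrite rev_path (eq_path (e' := e)) // => a b; exact: e_sym.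
Qed.

Lemma fset2_inj (V : choiceType) (x y x' y' : V) :
  ([fset x; y] = [fset x'; y'])%fset -> x = x' /\ y = y' \/ x = y' /\ y = x'.
Proof.
move=> eq_xy; have /fset2P xE : x \in [fset x'; y']%fset by rewrite -eq_xy fset21.
have /fset2P yE : y \in [fset x'; y']%fset by rewrite -eq_xy fset22.
have /fset2P x'E : x' \in [fset x; y]%fset by rewrite eq_xy fset21.
have /fset2P y'E : y' \in [fset x; y]%fset by rewrite eq_xy fset22.
by case: xE yE x'E y'E => -> [] -> [] ? [] ?; subst; by [left | right].
Qed.

Section Descent.
Variables (G : graph) (lev : G -> nat).
Hypothesis lev_adj : forall x y, adj G x y -> lev x <= (lev y).+1.
Implicit Types (x y u v w : G) (p q a b r : seq G).

Definition descends : rel G := [rel x y | adj G x y && (lev x == (lev y).+1)].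

Lemma lev_walk x p : path (adj G) x p ->
  lev x <= lev (last x p) + size p /\ lev (last x p) <= lev x + size p.
Proof.
elim: p x => [|y p IHp] x /=; first by rewrite addn0.
case/andP=> xy /IHp[]; have := lev_adj xy; rewrite adj_sym in xy.
by have := lev_adj xy; lia.
Qed.

Lemma descends_adj x p : path descends x p -> path (adj G) x p.
Proof. by apply: sub_path => a b /andP[]. Qed.

Lemma descends_lev x p : path descends x p -> lev x = lev (last x p) + size p.
Proof.
elim: p x => [|y p IHp] x /=; first by rewrite addn0.
by case/andP=> /andP[_ /eqP ->] /IHp ->; rewrite addnS.
Qed.

Lemma descends_split u p x : path descends u p -> x \in u :: p ->
  exists p1 p2, [/\ p = p1 ++ p2, last u p1 = x, path descends u p1,
                    path descends x p2 & lev u = lev x + size p1].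
Proof.
move=> + xp; case/splitPl: xp => p1 p2 <-; rewrite cat_path => /andP[up1 xp2].
by exists p1, p2; split=> //; exact: descends_lev.
Qed.

Lemma descends_uniq u p : path descends u p -> uniq (u :: p).
Proof.
move=> up; apply: (@sorted_uniq _ (fun x y => lev y < lev x)).
- by move=> y x z yx zy; exact: ltn_trans zy yx.
- by move=> x; rewrite ltnn.
by apply: sub_path up => x y /andP[_ /eqP ->].
Qed.

Lemma descends_edge u p x y : path descends u p ->
  [fset x; y]%fset \in path_edges (u :: p) ->
  [/\ adj G x y, x \in u :: p, y \in u :: p
    & lev x = (lev y).+1 \/ lev y = (lev x).+1].
Proof.
move=> up xyE.
have [x_p y_p] : x \in u :: p /\ y \in u :: p.
  by split; move: xyE; [|rewrite fsetUC]; apply: path_edges_mem.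
case/path_edgesP: xyE => s1 [s2 [x' [y' [def_p xy]]]].
have /andP[x'y' /eqP lev_x'] : descends x' y'.
  have : sorted descends (u :: p) by [].
  rewrite def_p; case: s1 {def_p} => [/andP[]//|z s1] /=.
  by rewrite cat_path /= => /and3P[_ _ /andP[]].
case: (fset2_inj xy) => -[eq_x eq_y]; split=> //; rewrite eq_x eq_y //; [by left | by rewrite adj_sym | by right].
Qed.

Lemma descends_walk u p x y : path descends u p -> x \in u :: p -> y \in u :: p ->
  exists q, [/\ path (edge_rel (path_edges (u :: p))) x q, last x q = y
              & size q = (lev x - lev y) + (lev y - lev x)].
Proof.
move=> up; wlog le_yx : x y / lev y <= lev x => [main xp yp|].
  case/orP: (leq_total (lev y) (lev x)) => [/main|/main]; first exact.
  case/(_ yp xp) => q [yq <- size_q].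
  have [] := path_rev _ yq; first by move=> a b; rewrite /edge_rel /= fsetUC.
  move=> yq' lq'; exists (rev (belast y q)).
  by rewrite size_rev size_belast size_q addnC.
move=> xp yp; have [p1 [p2 [def_p lx up1 xp2 lev_u]]] := descends_split up xp.
(* Levels drop strictly along the descent, so [y], being no higher than [x], cannot precede it
   unless they are equal. *)
have {}yp : y \in x :: p2.
  move: yp; rewrite def_p -cat_cons mem_cat => /orP[y_p1|yp2]; last by rewrite inE yp2 orbT.
  have [r1 [r2 [def_p1 ly _ yr2 _]]] := descends_split up1 y_p1.
  have := descends_lev yr2; rewrite -ly -last_cat -def_p1 lx ly.
  case: r2 def_p1 {yr2} => [|? ?] /=; last by lia.
  by rewrite cats0 => def_p1; rewrite inE -ly -lx def_p1 eqxx.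
have [q1 [q2 [def_p2 lq1 xq1 _ lev_x]]] := descends_split xp2 yp.
exists q1; split=> //; last by lia.
rewrite path_edge_rel def_p def_p2 -cat_cons (lastI u p1) lx cat_rcons -cat_cons.
exact: path_edges_sub.
Qed.

(** The level changes by at most one per edge of [G], so no walk is shorter than the difference of
    levels, and the descent attains it. *)
Lemma descends_geodesic u p : path descends u p -> geodesic_path (u :: p).
Proof.
move=> up; split; first by rewrite /= (descends_adj up) -cons_uniq (descends_uniq up).
move=> x y xp yp; have [q [xq lq size_q]] := descends_walk up xp yp.
have sub : subrel (edge_rel (path_edges (u :: p))) (adj G).
  by move=> a b /(descends_edge up)[].
have min_q q' : path (adj G) x q' -> last x q' = y -> size q <= size q'.
  by move=> xq' lq'; have [] := lev_walk xq'; rewrite lq' size_q; lia.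
rewrite (gdistE xq lq) => [|q' /(sub_path sub)]; last exact: min_q.
by rewrite /dist (gdistE (sub_path sub xq) lq).
Qed.

End Descent.

(** * The cycle through two far vertices *)

Ltac arith := repeat match goal with
  | H : is_true (leq _ _) |- _ => revert H
  | H : is_true (leq _ _ && leq _ _) |- _ => revert H
  | H : @eq nat _ _ |- _ => revert H
  | H : _ \/ _ |- _ => revert H
  end; clear; lia.

Definition has_geodesic_pair (G : graph) (k : nat) : Prop :=
  exists (c P Q : seq G),
    is_cycle (adj G) c /\
    path_of_cycle c P /\ path_of_cycle c Q /\
    [disjoint path_edges P & path_edges Q]%fset /\
    geodesic_path P /\ geodesic_path Q /\
    path_length P = k /\ path_length Q = k /\
    geodesic_loaded_cycle c (path_edges P `|` path_edges Q)%fset.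

Section GeodesicCycle.
Variables (G : graph) (lev : G -> nat).
Hypothesis lev_adj : forall x y, adj G x y -> lev x <= (lev y).+1.
Variables (k i : nat) (u v : G) (a b r : seq G).
Hypotheses (k_gt0 : 0 < k)
  (far : forall p, path (adj G) u p -> last u p = v -> k.*2 <= size p)
  (lev_u : lev u <= i <= (lev u).+1) (lev_v : lev v <= i <= (lev v).+1)
  (desc_a : path (descends lev) u a) (desc_b : path (descends lev) v b)
  (meet : last u a = last v b)
  (disj : forall x, x \in u :: a -> x \in v :: b -> x = last u a)
  (path_r : path (adj G) v (rcons r u)) (uniq_r : uniq (v :: rcons r u))
  (lev_r : all (fun x => i <= lev x) r).
Implicit Types (x y : G) (p : seq G).

(** Down [a] to the meeting vertex, up [b] to [v], back along [r]. [belast] drops the meeting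
    vertex, which already ends [u :: a]. *)
Let c := u :: a ++ rev (belast v b) ++ r.
Let P := u :: take k a.
Let Q := v :: take k b.
Let F := (path_edges P `|` path_edges Q)%fset.

(** Concatenating [p], [d] and the reverse of [q] gives a walk from [u] to [v]. *)
Let far_sum p q x y d : path (adj G) u p -> path (adj G) v q ->
  last u p = x -> last v q = y -> path (adj G) x d -> last x d = y ->
  k.*2 <= size p + size d + size q.
Proof.
move=> up vq lp lq xd ld.
have [] := path_rev (@adj_sym G) vq; rewrite lq -ld => yq lyq.
have := far (p := p ++ d ++ rev (belast v q)).
rewrite !cat_path !last_cat up lp xd ld -{1}ld yq -{1}ld lyq !size_cat size_rev size_belast addnA.
exact.
Qed.

Let lev_ua : lev u = lev (last u a) + size a.
Proof. exact: descends_lev desc_a. Qed.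

Let lev_vb : lev v = lev (last u a) + size b.
Proof. by rewrite meet; exact: descends_lev desc_b. Qed.

Let size_ab : k.*2 <= size a + size b.
Proof.
have := @far_sum a b _ _ [::] (descends_adj desc_a) (descends_adj desc_b) erefl (esym meet) isT erefl.
by rewrite addn0.
Qed.

(** The descents share their end and start at levels differing by at most one; were one shorter than
    [k], the sum would be at most [2k - 1]. *)
Let size_a : k <= size a. Proof. arith. Qed.
Let size_b : k <= size b. Proof. arith. Qed.

(** The value rises from [0] to [k] along [P], stays [k] until [Q] is reached, rises to [2k] along
    [Q] and stays there on [r]. *)
Let phi x : nat :=
  if x \in u :: a then minn (lev u - lev x) k
  else if x \in v :: b then k.*2 - minn (lev v - lev x) k else k.*2.

Let phi_a x : x \in u :: a -> phi x = minn (lev u - lev x) k.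
Proof. by rewrite /phi => ->. Qed.

(** At the meeting vertex, the only one on both descents, both formulas give [k], since each descent
    has length at least [k]. *)
Let phi_b x : x \in v :: b -> phi x = k.*2 - minn (lev v - lev x) k.
Proof.
move=> xb; rewrite /phi; case: ifPn => [xa|_]; last by rewrite xb.
by rewrite (disj xa xb); arith.
Qed.

Let lev_a x : x \in u :: a -> [/\ x = u \/ lev x < lev u, lev (last u a) <= lev x &
  exists p, [/\ path (adj G) u p, last u p = x & lev u = lev x + size p]].
Proof.
move=> /(descends_split desc_a)[p1 [p2 [-> lx up1 xp2 lev_x]]]; split.
- by case: p1 lx up1 lev_x => [|? ?] /= lx _ lev_x; [left | right; arith].
- by have := descends_lev xp2; rewrite last_cat lx => ->; rewrite leq_addr.
by exists p1; split=> //; exact: descends_adj up1.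
Qed.

Let lev_b x : x \in v :: b -> [/\ x = v \/ lev x < lev v, lev (last v b) <= lev x &
  exists p, [/\ path (adj G) v p, last v p = x & lev v = lev x + size p]].
Proof.
move=> /(descends_split desc_b)[p1 [p2 [-> lx up1 xp2 lev_x]]]; split.
- by case: p1 lx up1 lev_x => [|? ?] /= lx _ lev_x; [left | right; arith].
- by have := descends_lev xp2; rewrite last_cat lx => ->; rewrite leq_addr.
by exists p1; split=> //; exact: descends_adj up1.
Qed.

Let u_notin_r : u \notin r.
Proof. by move: uniq_r; rewrite /= rcons_uniq => /and3P[]. Qed.

Let v_notin_r : v \notin r.
Proof. by move: uniq_r; rewrite /= mem_rcons inE negb_or -andbA => /and3P[]. Qed.

(** After [u] the descent is strictly below [lev u <= i], while [r] stays in levels at least [i];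
    and [u] itself ends the path through [r]. *)
Let r_notin_a x : x \in r -> x \notin u :: a.
Proof.
move=> xr; have := allP lev_r _ xr; apply: contraL => /lev_a[[xu|lt_x] _ _]; last by arith.
by rewrite xu (negbTE u_notin_r) in xr.
Qed.

Let r_notin_b x : x \in r -> x \notin v :: b.
Proof.
move=> xr; have := allP lev_r _ xr; apply: contraL => /lev_b[[xv|lt_x] _ _]; last by arith.
by rewrite xv (negbTE v_notin_r) in xr.
Qed.

Let phi_r x : x \in r -> phi x = k.*2.
Proof. by move=> xr; rewrite /phi (negbTE (r_notin_a xr)) (negbTE (r_notin_b xr)). Qed.

Let belast_b x : x \in belast v b -> x \in v :: b /\ x \notin u :: a.
Proof.
move=> xb; have xb' : x \in v :: b by rewrite mem_belast.
split=> //; apply/negP => /disj /(_ xb'); rewrite meet => eq_x.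
have := descends_uniq desc_b; rewrite lastI rcons_uniq => /andP[+ _].
by rewrite -eq_x xb.
Qed.

Let mem_c x : x \in c -> [\/ x \in u :: a, x \in v :: b | x \in r].
Proof.
rewrite -[c]/((u :: a) ++ _) !mem_cat mem_rev => /or3P[xa|/belast_b[xb _]|xr].
- exact: Or31.
- exact: Or32.
exact: Or33.
Qed.

Let uniq_c : uniq c.
Proof.
rewrite -[c]/((u :: a) ++ _) cat_uniq (descends_uniq desc_a) /=.
rewrite cat_uniq rev_uniq !has_cat has_rev !negb_or.
have := descends_uniq desc_b; rewrite lastI rcons_uniq => /andP[_ ->].
have := uniq_r; rewrite /= rcons_uniq => /and3P[_ _ ->]; rewrite andbT /=.
rewrite -andbA; apply/and3P; split; apply/hasPn => x.
- by case/belast_b.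
- exact: r_notin_a.
by rewrite mem_rev; apply: contraL => /belast_b[xb _]; apply/negP => /r_notin_b; rewrite xb.
Qed.

Let cycle_c : cycle (adj G) c.
Proof.
rewrite /c /= !rcons_cat cat_path (descends_adj desc_a) meet cat_path /=.
have [vb lvb] := path_rev (@adj_sym G) (descends_adj desc_b).
by rewrite vb lvb.
Qed.

Let mono_c : path (fun x y => phi x <= phi y) u (a ++ rev (belast v b) ++ r).
Proof.
rewrite -[path _ _ _]/(sorted _ ((u :: a) ++ rev (belast v b) ++ r)).
have le_trans : transitive (fun x y => phi x <= phi y).
  by move=> y x z; exact: leq_trans.
(* By transitivity sortedness is pairwise, so it is checked inside [a], [b], [r] and between them:
   values are at most [k] on [a], at least [k] on [b], and [2k] on [r]. *)
rewrite sorted_pairwise // !pairwise_cat -!sorted_pairwise //.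
have le_k2 x : phi x <= k.*2 by rewrite /phi; do 2?case: ifP => _; arith.
apply/and3P; split.
- apply/allrelP => x y /phi_a ->; rewrite mem_cat mem_rev => /orP[/belast_b[/phi_b -> _]|/phi_r ->]; arith.
- apply: (@sub_in_sorted _ (mem (u :: a)) (descends lev)) => [x y xa ya|//|//]; last exact/allP.
  by case/andP=> _ /eqP; rewrite (phi_a xa) (phi_a ya); arith.
apply/and3P; split.
- by apply/allrelP => x y _ /phi_r ->.
- rewrite rev_sorted.
  apply: (@sub_in_sorted _ (mem (v :: b)) (descends lev)) => [x y xb yb||].
  + by case/andP=> _ /eqP; rewrite (phi_b xb) (phi_b yb); arith.
  + by apply/allP => x /belast_b[].
  have : sorted (descends lev) (v :: b) by [].
  by rewrite lastI -cats1 => /cat_sorted2[].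
apply: (@sub_in_sorted _ (mem r) (adj G)) => [x y xr yr _||].
+ by rewrite (phi_r xr) (phi_r yr).
+ exact/allP.
by move: path_r; rewrite -cats1 cat_path => /andP[/path_sorted].
Qed.

(** In the first [k] steps the cap at [k] cuts nothing off, so a drop of one level changes [phi] by
    one. The bounds by [k] here and in [phi_Q] serve to separate [P] from [Q]. *)
Let phi_P x y : [fset x; y]%fset \in path_edges P ->
  [/\ phi x <= k, phi y <= k & phi x = (phi y).+1 \/ phi y = (phi x).+1].
Proof.
have desc_P : path (descends lev) u (take k a) by exact: take_path.
move=> /(descends_edge desc_P)[_ xP yP lev_xy].
have PE z : z \in P -> z \in u :: a /\ lev u - lev z <= k.
  move=> zP; split.
    move: zP; rewrite !inE => /orP[->//|/mem_take ->]; exact: orbT.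
  have [p1 [p2 [def_p _ _ zp2 lev_z]]] := descends_split desc_P zP.
  by have := congr1 size def_p; rewrite size_cat size_takel //; arith.
have [[xa lev_x] [ya lev_y]] := (PE x xP, PE y yP).
have [_ _ [? [_ _ ?]]] := lev_a xa; have [_ _ [? [_ _ ?]]] := lev_a ya.
by rewrite (phi_a xa) (phi_a ya); split; arith.
Qed.

Let phi_Q x y : [fset x; y]%fset \in path_edges Q ->
  [/\ k <= phi x, k <= phi y & phi x = (phi y).+1 \/ phi y = (phi x).+1].
Proof.
have desc_Q : path (descends lev) v (take k b) by exact: take_path.
move=> /(descends_edge desc_Q)[_ xQ yQ lev_xy].
have QE z : z \in Q -> z \in v :: b /\ lev v - lev z <= k.
  move=> zQ; split.
    move: zQ; rewrite !inE => /orP[->//|/mem_take ->]; exact: orbT.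
  have [p1 [p2 [def_p _ _ zp2 lev_z]]] := descends_split desc_Q zQ.
  by have := congr1 size def_p; rewrite size_cat size_takel //; arith.
have [[xb lev_x] [yb lev_y]] := (QE x xQ, QE y yQ).
have [_ _ [? [_ _ ?]]] := lev_b xb; have [_ _ [? [_ _ ?]]] := lev_b yb.
by rewrite (phi_b xb) (phi_b yb); split; arith.
Qed.

Let phi_F x y : [fset x; y]%fset \in F -> phi x = (phi y).+1 \/ phi y = (phi x).+1.
Proof. by rewrite in_fsetU => /orP[/phi_P[]|/phi_Q[]]. Qed.

(** On one descent the values differ by no more than the levels do. Vertices of [r] have value [0]
    modulo [2k], and a walk to them from a descent climbs to level [i] or higher, hence at least as
    high as [u] and [v]. For distinct descents the walk from [u] to [v] is used. *)
Let phi_dist x y p : x \in c -> y \in c -> path (adj G) x p -> last x p = y ->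
  minn (phi x - phi y + (phi y - phi x)) (k.*2 - (phi x - phi y + (phi y - phi x)))
    <= size p.
Proof.
move=> /mem_c xc /mem_c yc xp px.
have [lev_xy lev_yx] := lev_walk lev_adj xp; rewrite px in lev_xy lev_yx.
have [yp py] := path_rev (@adj_sym G) xp; rewrite px in yp py.
case: xc => [xa|xb|xr]; case: yc => [ya|yb|yr].
- rewrite (phi_a xa) (phi_a ya).
  have [_ _ [? [_ _ ?]]] := lev_a xa; have [_ _ [? [_ _ ?]]] := lev_a ya; arith.
(* If neither vertex is more than [k] below its start, [far_sum] suffices. If [x] is [s > k] below
   [u] and [y] is [t <= k] below [v], the walk climbs at least [s - 1 - t >= k - t], as the levels
   of [u] and [v] differ by at most one; the mirrored case is alike. If both are deeper than [k],
   the values agree. *)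
- rewrite (phi_a xa) (phi_b yb).
  have [_ _ [p1 [up1 p1x ?]]] := lev_a xa; have [_ _ [p2 [vp2 p2y ?]]] := lev_b yb.
  have := far_sum up1 vp2 p1x p2y xp px; arith.
- rewrite (phi_a xa) (phi_r yr); have := allP lev_r _ yr.
  have [_ _ [? [_ _ ?]]] := lev_a xa; arith.
- rewrite (phi_b xb) (phi_a ya).
  have [_ _ [p1 [up1 p1x ?]]] := lev_a ya; have [_ _ [p2 [vp2 p2y ?]]] := lev_b xb.
  have := far_sum up1 vp2 p1x p2y yp py; rewrite size_rev size_belast; arith.
- rewrite (phi_b xb) (phi_b yb).
  have [_ _ [? [_ _ ?]]] := lev_b xb; have [_ _ [? [_ _ ?]]] := lev_b yb; arith.
- rewrite (phi_b xb) (phi_r yr); have := allP lev_r _ yr.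
  have [_ _ [? [_ _ ?]]] := lev_b xb; arith.
- rewrite (phi_r xr) (phi_a ya); have := allP lev_r _ xr.
  have [_ _ [? [_ _ ?]]] := lev_a ya; arith.
- rewrite (phi_r xr) (phi_b yb); have := allP lev_r _ xr.
  have [_ _ [? [_ _ ?]]] := lev_b yb; arith.
by rewrite (phi_r xr) (phi_r yr); arith.
Qed.

Let path_of_cycle_sub s : is_path (adj G) s -> (forall x, x \in s -> x \in c) ->
  (path_edges s `<=` cycle_edges c)%fset -> path_of_cycle c s.
Proof.
case: s => [//|x s] /andP[_ Us] sub_c sub_e; rewrite /path_of_cycle /is_path path_edge_rel sub_e Us.
exact/allP.
Qed.

Let sub_P : (path_edges P `<=` cycle_edges c)%fset.
Proof.
rewrite cycle_edgesE.
have -> : u :: rcons (a ++ rev (belast v b) ++ r) u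
        = [::] ++ P ++ (drop k a ++ rcons (rev (belast v b) ++ r) u).
  by rewrite rcons_cat /P /= catA cat_take_drop.
exact: path_edges_sub.
Qed.

Let sub_Q : (path_edges Q `<=` cycle_edges c)%fset.
Proof.
(* The cycle runs up [b], so it contains [Q] reversed. *)
rewrite cycle_edgesE -path_edges_rev.
have -> : u :: rcons (a ++ rev (belast v b) ++ r) u
        = belast u a ++ rev (drop k b) ++ rev Q ++ rcons r u.
  rewrite !rcons_cat -cat_cons lastI cat_rcons meet -[_ :: _ ++ _]cat_cons -rev_rcons -lastI -{1}(cat_take_drop k b).
  by rewrite -cat_cons rev_cat -catA.
by rewrite catA; exact: path_edges_sub.
Qed.

Lemma geodesic_cycle : has_geodesic_pair G k.
Proof.
have geo_P : geodesic_path P by apply: (descends_geodesic lev_adj); exact: take_path.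
have geo_Q : geodesic_path Q by apply: (descends_geodesic lev_adj); exact: take_path.
have is_cycle_c : is_cycle (adj G) c.
  rewrite /is_cycle uniq_c cycle_c !andbT /= !size_cat size_rev size_belast; arith.
exists c, P, Q; split=> //; split; last split; last split; last split=> //; last split=> //.
- apply: path_of_cycle_sub sub_P; first by case: geo_P.
  move=> x; rewrite /P /c !inE mem_cat => /orP[->//|/mem_take ->]; exact: orbT.
- apply: path_of_cycle_sub sub_Q; first by case: geo_Q.
  move=> x xQ; have : x \in v :: b.
    by move: xQ; rewrite !inE => /orP[->//|/mem_take ->]; exact: orbT.
  rewrite lastI mem_rcons inE -meet => /orP[/eqP ->|xb].
    by rewrite -[c]/((u :: a) ++ _) mem_cat mem_last.
  by rewrite -[c]/((u :: a) ++ _) !mem_cat mem_rev xb orbT.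
(* The ends of a common edge would both have value [k], yet their values differ by one. *)
- apply/fdisjointP => e /path_edgesP[s1 [s2 [x [y [def_P ->]]]]]; apply/negP => eQ.
  have [] := phi_Q eQ.
  have [|] := @phi_P x y; last by arith.
  by apply/path_edgesP; exists s1, s2, x, y.
split; first by rewrite /path_length /= size_takel.
split; first by rewrite /path_length /= size_takel.
split; first by split=> //; rewrite fsubUset sub_P sub_Q.
move=> x y xc yc; apply: le_gdist => p xp px.
apply: leq_trans (phi_dist xc yc xp px).
apply: (load_dist_le phi_F) => //.
- by rewrite phi_a ?mem_head // subnn min0n.
(* The last vertex of [c] is that of [r], or [v] if [r] is empty; its value is [2k] in both
   cases. *)
- rewrite !last_cat; case: r path_r phi_r => [|z r'] _ pr /=.
    case: b desc_b phi_b size_b => [|z b'] /=; first by arith.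
    by move=> _ pb _; rewrite rev_cons last_rcons pb ?mem_head // subnn min0n subn0.
  by apply: pr; exact: mem_last.
arith.
Qed.

End GeodesicCycle.

(** * Rooted trees *)

Lemma seq_argmax (T : eqType) (f : T -> nat) (s : seq T) : s != [::] ->
  exists2 x, x \in s & forall y, y \in s -> f y <= f x.
Proof.
elim: s => // x [|y s] IHs _.
  by exists x; rewrite ?mem_head // => y; rewrite inE => /eqP ->.
have [z zs max_z] := IHs isT; case: (leqP (f z) (f x)) => [zx|xz].
  exists x; rewrite ?mem_head // => t; rewrite inE => /predU1P[->//|/max_z tz].
  exact: leq_trans tz zx.
exists z; first by rewrite inE zs orbT.
by move=> t; rewrite inE => /predU1P[->|/max_z //]; exact: ltnW.
Qed.

Lemma path_joins (V : choiceType) (e : rel V) u p v : path e u p -> last u p = v ->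
  exists s, joins e u v s.
Proof.
move=> up <-; case: (shortenP up) => q uq Uq _.
by exists (u :: q); rewrite /joins /is_path uq Uq /= !eqxx.
Qed.

Section RootedTree.
Variables (T : choiceType) (root : T) (par : T -> T) (rank : T -> nat).
Hypotheses (par_root : par root = root)
  (rank_par : forall t, t != root -> rank t = (rank (par t)).+1).
Implicit Types (s t b : T) (p : seq T) (n : nat).

Definition par_adj : rel T :=
  [rel s t | (s != root) && (par s == t) || (t != root) && (par t == s)].

Lemma par_adj_sym : symmetric par_adj.
Proof. by move=> s t; rewrite /par_adj /= orbC. Qed.

Lemma par_adj_irr : irreflexive par_adj.
Proof.
move=> t; rewrite /par_adj /= orbb; apply/negbTE; apply/negP => /andP[/rank_par + /eqP].
by move=> + par_t; rewrite par_t; lia.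
Qed.

Definition par_tree : graph := Graph par_adj_sym par_adj_irr.

Lemma rank_iter n t : rank (iter n par t) <= rank t.
Proof.
elim: n => //= n IHn; apply: leq_trans IHn; set s := iter n par t.
by have [->|/rank_par ->] := eqVneq s root; rewrite ?par_root.
Qed.

Lemma path_to_root t : exists p, path par_adj t p /\ last t p = root.
Proof.
elim: {t}(rank t) {-2}t (leqnn (rank t)) => [|n IHn] t le_t.
  by exists [::]; split=> //=; apply/eqP; apply: contraTT le_t => /rank_par ->.
have [->|t_root] := eqVneq t root; first by exists [::].
have [|p [tp lp]] := IHn (par t); first by rewrite -ltnS -rank_par.
by exists (par t :: p); split=> //=; rewrite /par_adj /= t_root eqxx.
Qed.

Lemma par_tree_is_tree : is_tree par_tree.
Proof.
split; first exact: (inhabits (root : par_tree)).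
  move=> s t; have [p [sp lp]] := path_to_root s; have [q [tq lq]] := path_to_root t.
  have [qt lt] := path_rev par_adj_sym tq; rewrite lq -lp in qt lt.
  apply: (path_joins (p := p ++ rev (belast t q))); last by rewrite last_cat.
  by rewrite cat_path sp qt.
(* A vertex of greatest rank on a cycle can only have its parent as neighbour there, but it has two
   distinct neighbours. *)
case=> c /and3P[size_c cyc_c uniq_c].
have [|x xc max_x] := @seq_argmax _ rank c; first by case: c size_c {cyc_c uniq_c}.
have up y : par_adj x y -> y \in c -> y = par x.
  by case/orP=> /andP[/rank_par rank_y /eqP //] par_y /max_x; rewrite rank_y par_y ltnn.
have [i p rot_c] := rot_to xc.
have mem_p y : y \in p -> y \in c by rewrite -(mem_rot i c) rot_c inE => ->; rewrite orbT.
move: size_c cyc_c uniq_c; rewrite -(size_rot i) -(rot_cycle i) -(rot_uniq i) rot_c.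
case: p {rot_c} mem_p => [//|y p]; case/lastP: p => [//|p z] mem_p _ /=.
rewrite rcons_path last_rcons => /and3P[xy _ zx].
rewrite (up y xy) ?mem_p ?mem_head // mem_rcons inE.
by rewrite -(up z) ?eqxx ?andbF // ?mem_p ?inE ?mem_rcons ?inE ?eqxx ?orbT // par_adj_sym.
Qed.

(* A path leaving [D] at its only exit [a] cannot come back without visiting [a] again. *)
Lemma gate_convex (D : set T) a s p :
  (forall x y, par_adj x y -> D x -> ~ D y -> x = a) ->
  path par_adj s p -> uniq (s :: p) -> D s -> D (last s p) ->
  forall t, t \in s :: p -> D t.
Proof.
move=> gate; have enter x q : path par_adj x q -> ~ D x -> D (last x q) -> a \in q.
  elim: q x => [|y q IHq] x //= /andP[xy yq] nDx Dq.
  have [Dy|nDy] := pselect (D y); last by rewrite inE (IHq y) ?orbT.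
  by rewrite -(gate y x) ?mem_head // par_adj_sym.
elim: p s => [|y p IHp] s; first by move=> _ _ Ds _ t; rewrite inE => /eqP ->.
case/andP=> sy yp /andP[s_p Up] Ds Dl t.
have [Dy|nDy] := pselect (D y).
  by rewrite inE => /predU1P[->|] //; exact: IHp.
by have := enter _ _ yp nDy Dl; rewrite -(gate s y) // => s_p'; rewrite inE s_p' orbT in s_p.
Qed.

Definition below b : set T := [set t | exists n, iter n par t = b].

Lemma below_gate b x y : par_adj x y -> below b x -> ~ below b y -> x = b.
Proof.
case/orP=> /andP[_ /eqP par_xy] [n xb] nb; last by case: nb; exists n.+1; rewrite iterSr par_xy.
by case: n xb => // n; rewrite iterSr par_xy => yb; case: nb; exists n.
Qed.

Lemma below_coentry b x y : par_adj x y -> ~ below b x -> below b y -> x = par b.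
Proof.
move=> xy nb yb; have eq_yb : y = b by apply: below_gate yb nb; rewrite par_adj_sym.
case/orP: xy => /andP[_ /eqP par_xy]; last by rewrite -par_xy eq_yb.
by case: nb; exists 1; rewrite /= par_xy.
Qed.

(** [S] consists of [t0] and some of its children. The path stays below [t0], and it cannot enter
    the subtree of a vertex [b] outside [S] whose parent is in [S]. *)
Lemma star_convex (S : set T) t0 s p :
  S t0 -> (forall t, S t -> t = t0 \/ t != root /\ par t = t0) ->
  path par_adj s p -> uniq (s :: p) -> S s -> S (last s p) ->
  forall t, t \in s :: p -> S t.
Proof.
move=> S0 star sp Up Ss Sl t t_p.
have below0 x : S x -> below t0 x.
  by case/star=> [->|[_ <-]]; [exists 0 | exists 1].
have [n] := gate_convex (@below_gate t0) sp Up (below0 _ Ss) (below0 _ Sl) t_p.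
move=> iter_n; have {iter_n} : S (iter n par t) by rewrite iter_n.
(* Climbing from [t] to [t0], the first entry into [S] is from such a [b] to [par b]. *)
elim: n => //= n IHn Sn; apply: contrapT => nSt.
set b := iter n par t in IHn Sn; have nSb : ~ S b by move/IHn.
have b_root : b != root by apply/eqP => b_root; rewrite b_root par_root -b_root in Sn.
(* As [par b] has rank at least that of [t0], [b] has larger rank than [t0] and is no ancestor of
   it. *)
have not_below x : S x -> ~ below b x.
  have not0 m : iter m par t0 <> b.
    move=> eq_b; have := rank_iter m t0; rewrite eq_b (rank_par b_root) ltnNge => /negP; apply.
    have [->//|[r par_b]] := star _ Sn; by rewrite (rank_par r) par_b leqW.
  move=> Sx [[|m] /=]; first by move=> xb; apply: nSb; rewrite -xb.
  rewrite -iterS iterSr; have [->|[_ ->]] := star _ Sx; last exact: not0.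
  by rewrite -iterSr; exact: not0.
(* The complement of the subtree of [b] has [par b] as its only exit, and both ends of the path lie
   in it. *)
have := gate_convex (D := fun x => ~ below b x) (a := par b) _ sp Up.
move=> /(_ _ (not_below _ Ss) (not_below _ Sl) t t_p); apply; last by exists n.
by move=> x y xy nx /contrapT; exact: below_coentry.
Qed.

End RootedTree.

(** * Levels and the layered tree-decomposition *)

Lemma exists_canonical (T : choiceType) (E : T -> T -> Prop) :
  (forall x, E x x) -> (forall x y, E x y -> E y x) ->
  (forall y x z, E x y -> E y z -> E x z) ->
  exists f : T -> T, (forall x, E x (f x)) /\ (forall x y, E x y -> f x = f y).
Proof.
move=> E_refl E_sym E_trans; exists (fun x => xget x [set y | E x y]%classic); split=> [x|x y xy].
  by apply: (xgetPex x); exists x; exact: E_refl.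
have -> : [set z | E x z]%classic = [set z | E y z]%classic.
  by apply/seteqP; split=> z /=; apply: E_trans => //; exact: E_sym.
(* The defaults [x] and [y] differ, but the class is nonempty, so neither is returned. *)
rewrite /xget; case: pselect => // -[]; exists y; apply/asboolP; exact: E_refl.
Qed.

Section Levels.
Variable G : graph.
Implicit Types (u v w x y z : G) (p q : seq G) (i n : nat).

Definition connected u v : Prop := exists p, path (adj G) u p /\ last u p = v.

Lemma connected_sym u v : connected u v -> connected v u.
Proof.
by case=> p [up <-]; have [? ?] := path_rev (@adj_sym G) up; eexists; split; eassumption.
Qed.

Lemma connected_trans v u w : connected u v -> connected v w -> connected u w.
Proof.
by case=> p [up <-] [q [vq <-]]; exists (p ++ q); rewrite cat_path up vq last_cat.
Qed.

(** [lev x] is the distance to [f x], a root chosen once per component; the first edge of a shortest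
    walk to it leads one level down. *)
Lemma exists_levels : exists lev : G -> nat,
  [/\ forall x y, adj G x y -> lev x <= (lev y).+1,
      forall x, 0 < lev x -> exists y, adj G x y /\ lev x = (lev y).+1
    & forall x y, connected x y -> lev x = 0 -> lev y = 0 -> x = y].
Proof.
have [] := @exists_canonical G connected; first by move=> x; exists [::].
- exact: connected_sym.
- exact: connected_trans.
move=> f [conn_f eq_f].
have ex_n x : exists n, `[< exists p, [/\ path (adj G) x p, last x p = f x & size p = n] >].
  by have [p [xp lp]] := conn_f x; exists (size p); apply/asboolP; exists p.
exists (fun x => ex_minn (ex_n x)); split.
- move=> x y xy; case: ex_minnP => m _ min_m; case: ex_minnP => n /asboolP[p [yp lp <-]] _.
  apply: min_m; apply/asboolP; exists (y :: p); rewrite /= xy yp lp; split=> //.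
  by apply/esym/eq_f; exists [:: y]; rewrite /= xy.
- move=> x; case: ex_minnP => m /asboolP[p [xp lp <-]] min_m.
  case: p xp lp min_m => [//|y p] /= /andP[xy yp] lp min_m _; exists y; split=> //.
  have fxy : f x = f y by apply: eq_f; exists [:: y]; rewrite /= xy.
  case: ex_minnP => n /asboolP[q [yq lq <-]] min_n; congr S; apply/eqP.
  rewrite eqn_leq min_n; last by apply/asboolP; exists p; rewrite -fxy.
  rewrite andbT -ltnS; apply: min_m; apply/asboolP; exists (y :: q).
  by rewrite /= xy yq fxy.
move=> x y /eq_f f_xy; case: ex_minnP => m /asboolP[p [_ lp <-]] _ /size0nil p0.
case: ex_minnP => n /asboolP[q [_ lq <-]] _ /size0nil q0.
by rewrite p0 in lp; rewrite q0 in lq; rewrite /= in lp lq; rewrite lp lq.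
Qed.

Section Decomposition.
Variable lev : G -> nat.
Hypotheses (lev_adj : forall x y, adj G x y -> lev x <= (lev y).+1)
  (lev_down : forall x, 0 < lev x -> exists y, adj G x y /\ lev x = (lev y).+1).

Definition reach i u v : Prop :=
  exists p, [/\ path (adj G) u p, last u p = v & all (fun x => i <= lev x) (u :: p)].

Lemma reach_refl i u : i <= lev u -> reach i u u.
Proof. by exists [::]; split=> //=; rewrite andbT. Qed.

Lemma reach_sym i u v : reach i u v -> reach i v u.
Proof.
case=> p [up <- all_p]; have [pu lu] := path_rev (@adj_sym G) up.
exists (rev (belast u p)); split=> //.
by rewrite -rev_rcons -lastI all_rev.
Qed.

Lemma reach_trans i v u w : reach i u v -> reach i v w -> reach i u w.
Proof.
case=> p [up <- all_p] [q [vq <- /andP[_ all_q]]]; exists (p ++ q).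
rewrite cat_path up vq last_cat -cat_cons all_cat all_p; split=> //; exact: all_q.
Qed.

Lemma reach_le i j u v : i <= j -> reach j u v -> reach i u v.
Proof.
move=> ij [p [up lp all_p]]; exists p; split=> //.
by apply: sub_all all_p => x; exact: leq_trans.
Qed.

Lemma reach_adj i u v : adj G u v -> i <= lev u -> i <= lev v -> reach i u v.
Proof. by move=> uv iu iv; exists [:: v]; rewrite /= uv iu iv. Qed.

(* [w] stands for the component of the subgraph induced on levels at least [lev w];
   its bag consists of the [u] that are in level [lev w] of it, or just below and
   adjacent to it. *)
Definition in_bag w u : Prop :=
  (lev u = lev w /\ reach (lev w) u w) \/
  (lev w = (lev u).+1 /\ exists y, adj G u y /\ reach (lev w) y w).

(** The parent of a component is the component one level down that contains it. The extra root
    [None] joins the trees of the components of [G]. *)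
Lemma exists_tree_decomposition : exists D : tree_decomposition G,
  forall t u v, @td_bag G D t u -> @td_bag G D t v -> exists w, in_bag w u /\ in_bag w v.
Proof.
have [|||f [rep_f eq_f]] := @exists_canonical G (fun x y => lev x = lev y /\ reach (lev x) x y).
- by move=> x; split=> //; exact: reach_refl.
- by move=> x y [xy r]; split=> //; rewrite -xy; exact: reach_sym.
- move=> y x z [xy r] [yz r']; split; first by rewrite xy.
  by apply: reach_trans r _; rewrite xy.
have [d dP] : exists d : G -> G, forall x, 0 < lev x -> adj G x (d x) /\ lev x = (lev (d x)).+1.
  have : forall x, exists y, 0 < lev x -> adj G x y /\ lev x = (lev y).+1.
    move=> x; have [/lev_down[y ?]|] := boolP (0 < lev x); first by exists y.
    by exists x.
  by move=> /choice[d]; exists d.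
have lev_f x : lev (f x) = lev x by have [] := rep_f x.
have f_idem x : f (f x) = f x by apply/esym/eq_f.
pose par (t : option G) := if t is Some w then if lev w == 0 then None else Some (f (d w)) else None.
pose rank (t : option G) := if t is Some w then (lev w).+1 else 0.
have rank_par t : t != None -> rank t = (rank (par t)).+1.
  case: t => //= w _; case: eqP => [-> //|/eqP]; rewrite -lt0n => /dP[_ ->] /=.
  by rewrite lev_f.
(* Every [Some w] is a node, so those that are not representatives get the empty bag. *)
pose bag (t : option G) : set G := if t is Some w then [set u | f w = w /\ in_bag w u]%classic else set0.
have bag_self u : bag (Some (f u)) u.
  by split=> //; left; rewrite lev_f; have [] := rep_f u.
(* Apart from the bag of its own component, [u] lies only in bags of components one level up, to
   which it is adjacent; these are children of the first. *)
have star u t : bag t u -> t = Some (f u) \/ t != None /\ par t = Some (f u).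
  case: t => //= w [fw [[uw r]|[uw [y [uy r]]]]].
    by left; congr Some; rewrite -fw; apply/esym/eq_f; rewrite uw.
  right; split=> //; rewrite ifF ?uw //; congr Some; apply: eq_f.
  have [|wd lev_d] := dP w; first by rewrite uw.
  have lev_du : lev (d w) = lev u by lia.
  (* The links from [d w] to [w], to [y], to [u] all stay in levels at least [lev u]. *)
  split=> //; apply: (@reach_trans _ w).
    by apply: reach_adj; rewrite ?lev_d // adj_sym.
  apply: (@reach_trans _ y); last first.
    apply: reach_adj; rewrite 1?adj_sym ?lev_du //.
    by case: r => p [_ _ /andP[+ _]]; rewrite uw; exact: ltnW.
  by apply: reach_sym; apply: reach_le r; rewrite lev_d.
unshelve eexists.
  apply: (@TreeDecomposition G (@par_tree _ None par rank rank_par) bag).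
  - exact: par_tree_is_tree.
  - by move=> u; exists (Some (f u)); exact: bag_self.
  - move=> u v; wlog le_uv : u v / lev u <= lev v => [main uv|uv].
      case/orP: (leq_total (lev u) (lev v)) => [/main|/main]; first exact.
      by rewrite adj_sym => /(_ uv)[t []]; exists t.
    (* The bag of the higher end holds both, the lower one being at the same level or one below. *)
    exists (Some (f v)); split; last exact: bag_self.
    split=> //; rewrite /in_bag lev_f.
    have [_ r] := rep_f v; have := lev_adj; rewrite adj_sym in uv => /(_ _ _ uv) lev_vu.
    have [eq_uv|ne_uv] := eqVneq (lev u) (lev v).
      left; split=> //; apply: reach_trans r; apply: reach_adj; rewrite ?eq_uv //.
      by rewrite adj_sym.
    by right; split; [lia | exists v; rewrite adj_sym].
  move=> t1 t2 t3 [|s p] //= /and3P[/andP[sp Up] /eqP /= s1 /eqP /= s3] t2s u [b1 b3].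
  apply: (@star_convex _ None par rank erefl rank_par [set t | bag t u]%classic (Some (f u)) s p) => //=.
  - exact: bag_self.
  - by move=> t; exact: star.
  - by rewrite s1.
  - by rewrite s3.
by case=> [w|] u v //= [_ wu] [_ wv]; exists w.
Qed.

(** * From two far vertices of a bag to the cycle *)

Hypothesis lev_root : forall x y, connected x y -> lev x = 0 -> lev y = 0 -> x = y.

Lemma in_bag_reach w u : in_bag w u ->
  lev u <= lev w <= (lev u).+1 /\
  exists p, [/\ path (adj G) u p, last u p = w & all (fun x => lev w <= lev x) p].
Proof.
case=> [[uw [p [up lp /andP[_ all_p]]]]|[uw [y [uy [p [yp lp all_p]]]]]].
  by rewrite uw leqnn leqnSn; split=> //; exists p.
by rewrite uw leqnSn leqnn; split=> //; exists (y :: p); rewrite /= uy -uw.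
Qed.

Lemma descends_to_root u : exists p, path (descends lev) u p /\ lev (last u p) = 0.
Proof.
elim: {u}(lev u) {-2}u (erefl (lev u)) => [|n IHn] u lev_u; first by exists [::].
have [|y [uy lev_y]] := lev_down (x := u); first by rewrite lev_u.
have [|p [yp lp]] := IHn y; first by lia.
by exists (y :: p); rewrite /= /descends /= uy lev_y eqxx.
Qed.

Lemma first_hit (A : pred G) v p : has A (v :: p) ->
  exists p1 p2, [/\ p = p1 ++ p2, A (last v p1) & all (predC A) (belast v p1)].
Proof.
elim: p v => [|y p IHp] v; first by rewrite has_seq1 => Av; exists [::], [::].
have [Av _|nAv] := boolP (A v); first by exists [::], (y :: p).
rewrite [has _ _]/= (negbTE nAv) => /IHp[p1 [p2 [-> Al all_p]]].
by exists (y :: p1), p2; split; rewrite //= nAv.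
Qed.

Lemma bag_cycle w u v k : in_bag w u -> in_bag w v -> 0 < k ->
  (forall p, path (adj G) u p -> last u p = v -> k.*2 <= size p) ->
  has_geodesic_pair G k.
Proof.
move=> /in_bag_reach[lev_u [pu [upu lpu all_pu]]] /in_bag_reach[lev_v [pv [vpv lpv all_pv]]].
move=> k0 far.
have [a0 [ua0 la0]] := descends_to_root u; have [b0 [vb0 lb0]] := descends_to_root v.
(* Both vertices are connected to [w], so the descents end at the same root. *)
have eq_root : last u a0 = last v b0.
  apply: lev_root => //; apply: (@connected_trans w); last first.
    apply: connected_sym; apply: (@connected_trans v); last by exists pv.
    by apply: connected_sym; exists b0; split=> //; exact: descends_adj vb0.
  apply: (@connected_trans u); last by exists pu.
  by apply: connected_sym; exists a0; split=> //; exact: descends_adj ua0.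
(* Cutting the second descent at its first vertex on the first one leaves a single common vertex. *)
have [|b [b' [def_b0 lb_a0 all_b]]] := @first_hit (mem (u :: a0)) v b0.
  by apply/hasP; exists (last v b0); [exact: mem_last | rewrite -eq_root; exact: (mem_last u a0)].
have [a [a' [def_a0 la ua _ _]]] := descends_split ua0 lb_a0.
have vb : path (descends lev) v b by move: vb0; rewrite def_b0 cat_path => /andP[].
have uv : v != u by apply/eqP => uv; have := far [::] isT (esym uv); rewrite leqn0 double_eq0 -leqn0 leqNgt k0.
have [uqv lqv] := path_rev (@adj_sym G) upu; rewrite lpu -lpv in uqv lqv.
(* From [v] to [w] and on to [u]; shortened to a path, this yields [r]. *)
have vp : path (adj G) v (pv ++ rev (belast u pu)) by rewrite cat_path vpv uqv.
have : last v (pv ++ rev (belast u pu)) = u by rewrite last_cat.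
case: (shortenP vp) => p' vp' Up' sub_p'; case/lastP: p' vp' Up' sub_p' => [|r z].
  by move=> _ _ _ /= vu; rewrite vu eqxx in uv.
rewrite last_rcons => vr Ur sub_r zu; rewrite {z}zu in vr Ur sub_r.
apply: (@geodesic_cycle G lev lev_adj k (lev w) u v a b r) => //.
  move=> x; rewrite la => xa; rewrite lastI mem_rcons inE => /predU1P[//|/(allP all_b) /negP[]].
  by move: xa; rewrite /= def_a0 -cat_cons mem_cat => ->.
apply/allP => x xr; have /sub_r : x \in rcons r u by rewrite mem_rcons inE xr orbT.
rewrite mem_cat mem_rev => /orP[/(allP all_pv)//|/mem_belast].
(* [u] may lie one level below [lev w], but it is the end of the path and so not in [r]. *)
rewrite inE => /predU1P[xu|/(allP all_pu)//].
by move: Ur; rewrite /= rcons_uniq -xu xr andbF.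
Qed.

End Decomposition.
End Levels.

(** * The outer diameter *)

Section OuterDiameterWidth.
Variable G : graph.

Lemma is_enat_diameter (B : set G) : is_enat (diameter B).
Proof. by apply: is_enat_supremum => _ [u _ [v _ <-]]; exact: is_enat_gdist. Qed.

Lemma is_enat_outer_diameter (D : tree_decomposition G) : is_enat (outer_diameter D).
Proof. by apply: is_enat_supremum => _ [t _ <-]; exact: is_enat_diameter. Qed.

Lemma is_enat_odw : is_enat (odw G).
Proof. by apply: is_enat_infimum => _ [D ->]; exact: is_enat_outer_diameter. Qed.

(** Otherwise all distances within bags, being integral, are at most [n], and so is the outer
    diameter of [D]. *)
Lemma odw_far_pair (D : tree_decomposition G) n : (enat n.+1 <= odw G)%E ->
  exists t u v, [/\ @td_bag G D t u, @td_bag G D t v & (enat n.+1 <= dist u v)%E].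
Proof.
move=> le_odw; apply: contrapT => no_pair; move: le_odw; apply/negP; rewrite -ltNge.
apply: (@le_lt_trans _ _ (enat n)); last by rewrite ltNge enat_le ltnn.
apply: (@le_trans _ _ (outer_diameter D)).
  by apply: infimum_lbound; [move=> _ [D' ->]; exact: is_enat_outer_diameter | exists D].
apply: supremum_lub => [_ [t _ <-]||_ [t _ <-]]; [exact: is_enat_diameter | exact: enat_ge0|].
apply: supremum_lub => [_ [u _ [v _ <-]]||_ [u tu [v tv <-]]].
- exact: is_enat_gdist.
- exact: enat_ge0.
apply: is_enat_ltS; first exact: is_enat_gdist.
by rewrite ltNge; apply/negP => le_uv; apply: no_pair; exists t, u, v.
Qed.

Lemma odw_cycle k : 0 < k -> (enat k.*2 <= odw G)%E ->
  has_geodesic_pair G k.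
Proof.
move=> k0 le_odw; have [lev [lev_adj lev_down lev_root]] := exists_levels G.
have [D bagD] := exists_tree_decomposition lev_adj lev_down.
have [|t [u [v [tu tv far]]]] := @odw_far_pair D k.*2.-1; first by rewrite prednK ?double_gt0.
have [w [wu wv]] := bagD t u v tu tv.
apply: (bag_cycle lev_adj lev_down lev_root wu wv k0).
by rewrite prednK ?double_gt0 // in far; exact: gdist_geP far.
Qed.

(** Both paths are a single vertex of the given cycle and its load is zero. *)
Lemma trivial_cycle : has_cycle G ->
  has_geodesic_pair G 0.
Proof.
case=> -[//|x c] cyc_c; exists (x :: c), [:: x], [:: x].
have geo_x : geodesic_path [:: x].
  (* With constant level a single vertex is a descent of length zero. *)
  by apply: (@descends_geodesic _ (fun=> 0) _ x [::]).
have path_x : path_of_cycle (x :: c) [:: x] by rewrite /path_of_cycle /= mem_head.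
rewrite path_edges1 fsetUid; do 3!split=> //; split; first by rewrite /fdisjoint fset0I.
do 4!split=> //; split; first by split=> //; exact: fsub0set.
move=> u v _ _; apply: le_gdist => p _ _.
by rewrite /load_dist !fsetI0 cardfs0 if_same.
Qed.

(** The edge sets of [P] and [Q] are disjoint and have [k] elements each, so the load is [2k]. *)
Lemma glc_ge k : 0 < k -> (enat k.*2 <= odw G)%E -> (enat k.*2 <= glc G)%E.
Proof.
move=> k0 /(odw_cycle k0)[c [P [Q [_ [_ [_ [disj [geoP [geoQ [lP [lQ geo]]]]]]]]]]].
apply: supremum_ubound; first by move=> _ [c' [F [_ ->]]]; left; eexists.
exists c, (path_edges P `|` path_edges Q)%fset; split=> //; congr enat.
have uniq_path s : geodesic_path s -> uniq s by case: s => [[]//|x s] [/andP[]].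
rewrite cardfsU (eqP (disj : _ == _)) cardfs0 subn0 !card_path_edges ?lP ?lQ ?addnn //.
all: exact: uniq_path.
Qed.

End OuterDiameterWidth.

Lemma glc_ge0 G : (0 <= glc G)%E.
Proof.
apply: is_enat_ge0; apply: is_enat_supremum => _ [c [F [_ ->]]]; left; eexists; reflexivity.
Qed.

Lemma floor_half_enat n : floor_half (enat n) = enat n./2.
Proof. by rewrite /floor_half /enat /= divz_nat divn2. Qed.

(* When odw G = +oo no path has length floor (odw G / 2), and the second part
   is read as holding for every finite length k. *)
Theorem theorem3p1 (G : graph) :
  (2%:E * floor_half (odw G) <= glc G)%E /\
  (has_cycle G ->
   forall k : nat,
     floor_half (odw G) = enat k \/ floor_half (odw G) = +oo%E ->
     exists (c P Q : seq G),
       is_cycle (adj G) c /\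
       path_of_cycle c P /\ path_of_cycle c Q /\
       [disjoint path_edges P & path_edges Q]%fset /\
       geodesic_path P /\ geodesic_path Q /\
       path_length P = k /\ path_length Q = k /\
       geodesic_loaded_cycle c (path_edges P `|` path_edges Q)%fset).
Proof.
split=> [|cycG k odw_k].
  have [[n odw_n]|odw_oo] := is_enat_odw G.
    rewrite odw_n floor_half_enat -EFinM -PoszM mul2n.
    have [->|] := posnP n./2; first exact: glc_ge0.
    move=> /(@glc_ge G); apply; rewrite odw_n enat_le -{2}(odd_double_half n); exact: leq_addl.
  (* With infinite [odw G], each [n] gives a geodesic loaded cycle of load [2(n + 1)]. *)
  suff -> : glc G = +oo%E by exact: leey.
  apply: le_enat_oo => n; apply: le_trans (glc_ge (ltn0Sn n) _).
    by rewrite enat_le -addnn; lia.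
  by rewrite odw_oo leey.
have [->|k0] := posnP k; first exact: trivial_cycle.
apply: odw_cycle => //; case: (is_enat_odw G) odw_k => [[n ->]|->]; last by rewrite leey.
rewrite floor_half_enat enat_le => -[[<-]|//].
by rewrite -{2}(odd_double_half n) leq_addl.
Qed.
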